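(* If the sequence $(A_m)_{m\in\mathbb N}$ admits a nonuniform logarithmic dichotomy with respect to a sequence of norms $(\|\cdot\|_m)_{m\in\mathbb N}$, with projections $P_m$ and complementary projections $Q_m=\mathrm{Id}-P_m$, then the operator $T^\nu_{\operatorname{Im}Q_1}$ (that is, $T^\nu_Z$ with $Z=\operatorname{Im}Q_1$) is invertible.
   Context: $\mathbb N=\{1,2,\dots\}$ and $\nu=(\nu_n)_{n\in\mathbb N}$ is the sequence $\nu_n=\log(n+1)$ (natural logarithm). $(X,\|\cdot\|)$ is a Banach space and $(A_n)_{n\in\mathbb N}$ is a sequence of bounded linear operators on $X$. For $m\ge n$, $\mathcal A_{m,n}=A_{m-1}\cdots A_n$ if $m>n$ and $\mathcal A_{m,n}=\mathrm{Id}$ if $m=n$. $(\|\cdot\|_m)_{m\in\mathbb N}$ is a sequence of norms on $X$ such that each $\|\cdot\|_m$ is equivalent to $\|\cdot\|$. $(A_m)$ admits a nonuniform logarithmic dichotomy with respect to $(\|\cdot\|_m)$ if there are projections $P_m$, $m\in\mathbb N$, on $X$ such that $A_m|_{\ker P_m}:\ker P_m\to\ker P_{m+1}$ is invertible for all $m$, $P_m\mathcal A_{m,n}=\mathcal A_{m,n}P_n$ for $m\ge n$, and there are constants $\lambda,D>0$ such that for all $x\in X$ and $m,n\in\mathbb N$: $\|\mathcal A_{m,n}P_nx\|_m\le D(\nu_m/\nu_n)^{-\lambda}\|x\|_n$ for $m\ge n$, and $\|\mathcal A_{m,n}Q_nx\|_m\le D(\nu_n/\nu_m)^{-\lambda}\|x\|_n$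 for $m\le n$, where $Q_n=\mathrm{Id}-P_n$ and, for $m\le n$, $\mathcal A_{m,n}=(\mathcal A_{n,m})^{-1}:\ker P_n\to\ker P_m$. For a sequence $x=(x_m)_{m\in\mathbb N}$ in $X$ put $\|x\|_\infty=\sup_m\|x_m\|_m$; $Y$ is the space of sequences with $\|x\|_\infty<\infty$; for a subspace $Z\subset X$, $Y_Z=\{x\in Y:x_1\in Z\}$, and $Y_0=Y_{\{0\}}$. The linear operator $T^\nu_Z:\mathcal D(T^\nu_Z)\to Y_0$ is given by $(T^\nu_Zx)_1=0$ and $(T^\nu_Zx)_m=\dfrac{\log(m+1)}{\log(1+1/(m+1))}(x_m-A_{m-1}x_{m-1})$ for $m\ge2$, with domain $\mathcal D(T^\nu_Z)=\{x\in Y_Z:T^\nu_Zx\in Y_0\}$ endowed with the norm $\|x\|_{T^\nu_Z}=\|x\|_\infty+\|T^\nu_Zx\|_\infty$. $Y_0$ carries $\|\cdot\|_\infty$. Invertible means bijective with bounded inverse. *)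

(* Defs.v *)
From HB Require Import structures.
From mathcomp Require Import all_boot all_order all_algebra.
From mathcomp Require Import all_classical all_reals all_analysis.
From mathcomp Require Import complex.

Set Implicit Arguments.
Unset Strict Implicit.
Unset Printing Implicit Defensive.

Import Order.TTheory GRing.Theory Num.Theory.
Import numFieldNormedType.Exports.

Local Open Scope classical_set_scope.
Local Open Scope ring_scope.

(* The scalar field of a Banach space is R or C.  The library norm of a
   K-normed module takes its values in K, so for K = C a real-valued absolute
   value and the embedding of R in K are needed.  A numFieldType K with this
   structure is an extension of R with an archimedean absolute value extending
   that of R, hence is R or C; the two cases are [real_scalars] and
   [complex_scalars]. *)
Record scalars (R : realType) (K : numFieldType) := Scalars {
  emb : {rmorphism R -> K};
  emb_mono : {mono emb : r s / r <= s};
  absv : K -> R;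
  absvE : forall z : K, `|z| = emb (absv z) }.

Section RealComplex.
Variable R : realType.

Definition real_scalars : scalars R R.
Proof. by exists idfun (@Num.norm R R). Defined.

Definition complex_scalars : scalars R (complex.complex R).
Proof.
exists (complex.real_complex R : {rmorphism R -> complex.complex R})
  (@complex.ComplexField.Normc.normc R).
- by move=> r s; rewrite /= complex.lecR.
- by case.
Defined.

End RealComplex.

(* All sequences indexed by {1, 2, ...} are indexed here by nat with a shift:
   entry i is the entry of index i + 1 in the usual numbering. *)

Definition nu {R : realType} (i : nat) : R := ln i.+2%:R.

Section Dichotomy.
Variables (R : realType) (K : numFieldType) (sc : scalars R K).
Variable X : completeNormedModType K.
Implicit Types (A P : nat -> {linear X -> X}) (N : nat -> X -> R).

Definition rnorm (x : X) : R := absv sc `|x|.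

Definition bounded_op (f : X -> X) : Prop :=
  exists C : R, forall x : X, rnorm (f x) <= C * rnorm x.

Definition is_norm (p : X -> R) : Prop :=
  [/\ forall x y : X, p (x + y) <= p x + p y,
      forall (a : K) (x : X), p (a *: x) = absv sc a * p x
    & forall x : X, p x = 0 -> x = 0].

Definition equivalent_norm (p : X -> R) : Prop :=
  exists c C : R, [/\ 0 < c, 0 < C &
    forall x : X, c * rnorm x <= p x <= C * rnorm x].

(* evol A n k = A_{n+k-1} ... A_n *)
Fixpoint evol A (n k : nat) (x : X) : X :=
  if k is k'.+1 then A (n + k')%N (evol A n k' x) else x.

(* Only meaningful for n <= m. *)
Definition cocycle A (m n : nat) : X -> X := evol A n (m - n).

Definition kernel (f : X -> X) : set X := [set x | f x = 0].

Definition compl_proj P (n : nat) (x : X) : X := x - P n x.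

(* For m <= n, the inverse of cocycle A n m : ker P_m -> ker P_n; its values
   outside of ker P_n are irrelevant. *)
Definition back_cocycle A P (m n : nat) : X -> X :=
  'pinv_(fun=> 0) (kernel (P m)) (cocycle A n m).

(* The projections are not assumed to be bounded: this follows from the
   estimate ld_stable with m = n. *)
Record log_dichotomy A N P : Prop := LogDichotomy {
  ld_proj : forall m x, P m (P m x) = P m x;
  ld_inv : forall m, set_bij (kernel (P m)) (kernel (P m.+1)) (A m);
  ld_comm : forall m n x, (n <= m)%N ->
    P m (cocycle A m n x) = cocycle A m n (P n x);
  ld_bounds : exists lambda D : R, [/\ 0 < lambda, 0 < D,
    forall m n x, (n <= m)%N ->
      N m (cocycle A m n (P n x)) <= D * (nu m / nu n) `^ (- lambda) * N n x &
    forall m n x, (m <= n)%N ->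
      N m (back_cocycle A P m n (compl_proj P n x))
        <= D * (nu n / nu m) `^ (- lambda) * N n x] }.

Definition supnorm N (x : nat -> X) : \bar R :=
  ereal_sup (range (fun m => (N m (x m))%:E)).

Definition Yspace N : set (nat -> X) := [set x | (supnorm N x < +oo)%E].

Definition YZ N (Z : set X) : set (nat -> X) :=
  [set x | Yspace N x /\ Z (x 0%N)].

Definition Y0 N : set (nat -> X) := YZ N [set 0].

(* Entry i.+1 has usual index m = i + 2, so that log (m + 1) = nu i.+1 and
   m + 1 = i.+3. *)
Definition Top A (x : nat -> X) (j : nat) : X :=
  if j is i.+1 then
    emb sc (nu i.+1 / ln (1 + i.+3%:R^-1)) *: (x i.+1 - A i (x i))
  else 0.

Definition Tdom A N (Z : set X) : set (nat -> X) :=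
  [set x | YZ N Z x /\ Y0 N (Top A x)].

Definition graph_norm A N (x : nat -> X) : \bar R :=
  (supnorm N x + supnorm N (Top A x))%E.

Definition Tinv A N (Z : set X) : (nat -> X) -> (nat -> X) :=
  'pinv_(fun=> fun=> 0) (Tdom A N Z) (Top A).

Definition T_invertible A N (Z : set X) : Prop :=
  set_bij (Tdom A N Z) (Y0 N) (Top A) /\
  exists C : R, forall y : nat -> X, Y0 N y ->
    (graph_norm A N (Tinv A N Z y) <= C%:E * supnorm N y)%E.

End Dichotomy.

(* Main.v *)
Require Import Defs.
From HB Require Import structures.
From mathcomp Require Import all_boot all_order all_algebra.
From mathcomp Require Import all_classical all_reals all_analysis.
From mathcomp Require Import zify ring lra.

Set Implicit Arguments.
Unset Strict Implicit.
Unset Printing Implicit Defensive.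

Import Order.TTheory GRing.Theory Num.Theory.
Import numFieldNormedType.Exports.

Local Open Scope classical_set_scope.
Local Open Scope ring_scope.

(** The equation [Top x = y] is the inhomogeneous recurrence
    [x (n+1) = A n (x n) + f (n+1)] with forcing term [f n = relgap n *: y n],
    where [relgap n = nu (n+1) / nu n - 1] is, for positive [n], the inverse of
    the weight in [Top] (lemma [TopP]).  Its bounded solution is given by the
    Green function of the dichotomy: push the stable parts of the past forcing terms forward, and pull
    the unstable parts of the future ones back,
    [x n = \sum_(k <= n) A(n, k) (P k (f k)) - \sum_(k > n) A(n, k) (Q k (f k))].

    The weight is chosen so that this is bounded.  With [r = nu (k+1) / nu k],
    which lies between 1 and 2, the gap [r - 1] is at most a constant times
    [r ^ l - 1], and at most a constant times [1 - r ^ (- l)].  Multiplied by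
    [nu k ^ l], respectively [nu k ^ (- l)], these bounds become differences of
    consecutive values of [nu ^ l] and [nu ^ (- l)], so both sums are dominated by
    telescoping sums: lemmas [stable_part_le] and [unstable_part].  The second sum
    is infinite, and its terms are dominated by the differences of a sequence
    tending to 0; [telescoping_series] provides its value, together with an
    explicit bound for the remainders, from which the recurrence and the
    condition at the initial time follow.  All estimates are linear in the
    supremum norm of [y], so the solution operator is bounded.

    For injectivity, a bounded solution of the homogeneous recurrence that starts
    in [ker P 0] remains in the unstable spaces; pulling it back from time [n] to
    time 0 shows that its initial value has norm [O (nu n ^ (- l))], which tends
    to 0 (lemma [solution_eq0]). *)

(** * Growth of the rate sequence *)

Section PowerEstimates.
Context {R : realType}.
Implicit Types a l r : R.

Lemma ln_ge_1BV r : 0 < r -> 1 - r^-1 <= ln r.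
Proof.
move=> r0; have h : ln (1 + (r^-1 - 1)) <= r^-1 - 1.
  by apply: le_ln1Dx; rewrite ltrBDl addrN invr_gt0.
by rewrite addrC subrK lnV ?posrE // in h; lra.
Qed.

(** Since [r ^ l >= 1 + l * ln r] and [ln r >= (r - 1) / r >= (r - 1) / 2]. *)
Lemma growth_le_powR_diff l r : 0 < l -> 1 <= r <= 2 ->
  r - 1 <= 2 / l * (r `^ l - 1).
Proof.
move=> l0 /andP[r1 r2]; have r0 : 0 < r by lra.
have h1 : l * ln r <= r `^ l - 1.
  rewrite lerBrDl /powR gt_eqF //; exact: expR_ge1Dx.
have h2 : (r - 1) / 2 <= ln r.
  have h3 := ln_ge_1BV r0.
  have h4 : 1 - r^-1 = (r - 1) / r by field; lra.
  have : (r - 1) / 2 <= (r - 1) / r.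
    by rewrite ler_wpM2l ?subr_ge0 // lef_pV2 ?posrE.
  by lra.
have -> : 2 / l * (r `^ l - 1) = 2 * ((r `^ l - 1) / l) by field; lra.
have : ln r <= (r `^ l - 1) / l by rewrite ler_pdivlMr // mulrC.
lra.
Qed.

(** Since [r ^ l - 1 = r ^ l * (1 - r ^ (- l))] and [r ^ l <= 2 ^ l]. *)
Lemma growth_le_powRN_diff l r : 0 < l -> 1 <= r <= 2 ->
  r - 1 <= 2 / l * 2 `^ l * (1 - r `^ (- l)).
Proof.
move=> l0 r12; have /andP[r1 r2] := r12; have r0 : 0 < r by lra.
have p0 : 0 < r `^ l by apply: powR_gt0.
apply: (le_trans (growth_le_powR_diff l0 r12)).
rewrite -[leRHS]mulrA ler_wpM2l ?divr_ge0 ?(ltW l0) //.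
have -> : r `^ l - 1 = r `^ l * (1 - r `^ (- l)).
  by rewrite powRN mulrBr mulr1 divff // gt_eqF.
have rN : 0 <= 1 - r `^ (- l).
  by rewrite powRN subr_ge0 invf_le1 // -(powRr0 r) ler_powR // ltW.
by rewrite (ler_wpM2r rN) // ge0_ler_powR ?nnegrE ?(ltW l0) ?(ltW r0).
Qed.

End PowerEstimates.

Section Rate.
Context {R : realType}.
Local Notation nu := (@nu R).

Lemma nu_gt0 n : 0 < nu n.
Proof. by rewrite ln_gt0 // ltr1n. Qed.

Lemma le_nu m n : (m <= n)%N -> nu m <= nu n.
Proof. by move=> mn; rewrite ler_ln ?posrE ?ltr0n // ler_nat !ltnS. Qed.

(** Since [n + 3 <= (n + 2) ^ 2]. *)
Lemma nuS_le_double n : nu n.+1 <= 2 * nu n.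
Proof.
rewrite /Defs.nu mulr_natl -lnXn ?ltr0n // ler_ln ?posrE ?exprn_gt0 ?ltr0n //.
by rewrite -natrX ler_nat; lia.
Qed.

Definition relgap n : R := nu n.+1 / nu n - 1.

Lemma nuS_ratio n : 1 <= nu n.+1 / nu n <= 2.
Proof.
by rewrite ler_pdivlMr ?ler_pdivrMr ?nu_gt0 // mul1r le_nu //= nuS_le_double.
Qed.

(** The inverse of the weight in [Top]: the logarithm in its denominator is the
    increment [nu (n+2) - nu (n+1)]. *)
Lemma weight_inv n : (nu n.+1 / ln (1 + n.+3%:R^-1))^-1 = relgap n.+1.
Proof.
have -> : 1 + n.+3%:R^-1 = n.+4%:R / n.+3%:R :> R.
  by rewrite -[n.+4%:R]natr1 mulrDl divff ?mul1r // pnatr_eq0.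
rewrite ln_div ?posrE ?ltr0n // invf_div /relgap mulrBl divff //.
by rewrite gt_eqF // nu_gt0.
Qed.

Lemma relgap_gt0 n : 0 < relgap n.
Proof.
rewrite subr_gt0 ltr_pdivlMr ?nu_gt0 // mul1r.
by rewrite ltr_ln ?posrE ?ltr0n // ltr_nat.
Qed.

Lemma nu_powR_cvg0 (l : R) : 0 < l ->
  (fun n => nu n `^ (- l)) @ \oo --> (0 : R).
Proof.
move=> l0; apply/cvgrPdist_le => e e0.
(* With this t, the inequality nu n >= t gives nu n ^ (- l) <= e. *)
pose t := e `^ (- l^-1).
have t0 : 0 < t by apply: powR_gt0.
near=> n.
rewrite sub0r normrN ger0_norm ?powR_ge0 //.
have -> : e = t `^ (- l).
  by rewrite /t -powRrM mulrNN mulVf ?gt_eqF // powRr1 // ltW.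
rewrite !powRN lef_pV2 ?posrE ?powR_gt0 ?nu_gt0 //.
apply: ge0_ler_powR; rewrite ?nnegrE ?(ltW (nu_gt0 _)) ?(ltW l0) ?(ltW t0) //.
apply: ltW; rewrite -[t]expRK ltr_ln ?posrE ?expR_gt0 ?ltr0n //.
have : expR t < n%:R by near: n; exact: nbhs_infty_gtr.
by move/lt_le_trans; apply; rewrite ler_nat; lia.
Unshelve. all: by end_near. Qed.

Lemma nu_ratio_powRN (l : R) m n :
  (nu m / nu n) `^ (- l) = nu n `^ l * nu m `^ (- l).
Proof.
rewrite powRM ?invr_ge0 ?(ltW (nu_gt0 _)) // mulrC; congr (_ * _).
by rewrite -powR_inv1 ?(ltW (nu_gt0 _)) // -powRrM mulN1r opprK.
Qed.

Lemma relgap_le_powR_diff (l : R) k : 0 < l ->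
  nu k `^ l * relgap k <= 2 / l * (nu k.+1 `^ l - nu k `^ l).
Proof.
move=> l0; have k0 := nu_gt0 k; have p0 : 0 < nu k `^ l by apply: powR_gt0.
have -> : nu k.+1 `^ l = nu k `^ l * (nu k.+1 / nu k) `^ l.
  rewrite -powRM ?divr_ge0 ?(ltW (nu_gt0 _)) //; congr (_ `^ _).
  by field; rewrite gt_eqF.
have h := growth_le_powR_diff l0 (nuS_ratio k).
have := ler_wpM2l (ltW p0) h; rewrite /relgap => /le_trans; apply.
lra.
Qed.

Lemma relgap_le_powRN_diff (l : R) k : 0 < l ->
  nu k `^ (- l) * relgap k
    <= 2 / l * 2 `^ l * (nu k `^ (- l) - nu k.+1 `^ (- l)).
Proof.
move=> l0; have k0 := nu_gt0 k; have p0 : 0 < nu k `^ (- l) by apply: powR_gt0.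
have -> : nu k.+1 `^ (- l) = nu k `^ (- l) * (nu k.+1 / nu k) `^ (- l).
  rewrite -powRM ?divr_ge0 ?(ltW (nu_gt0 _)) //; congr (_ `^ _).
  by field; rewrite gt_eqF.
have h := growth_le_powRN_diff l0 (nuS_ratio k).
have := ler_wpM2l (ltW p0) h; rewrite /relgap => /le_trans; apply.
lra.
Qed.

End Rate.

(** * Norms over the scalar field and telescoping series *)

Section Scalars.
Context {R : realType} {K : numFieldType} (sc : scalars R K).

Lemma emb_inj : injective (emb sc).
Proof. by move=> r s e; apply/eqP; rewrite eq_le -!(emb_mono sc) e lexx. Qed.

Lemma emb_lt : {mono emb sc : r s / r < s}.
Proof. by move=> r s; rewrite !lt_neqAle (emb_mono sc) (inj_eq emb_inj). Qed.

Lemma absv_ge0 z : 0 <= absv sc z.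
Proof. by rewrite -(emb_mono sc) rmorph0 -absvE normr_ge0. Qed.

Lemma absv_emb r : 0 <= r -> absv sc (emb sc r) = r.
Proof.
move=> r0; apply: emb_inj; rewrite -absvE ger0_norm //.
by rewrite -(rmorph0 (emb sc)) (emb_mono sc).
Qed.

Lemma absv0 : absv sc 0 = 0.
Proof. by rewrite -(rmorph0 (emb sc)) absv_emb. Qed.

Lemma absvN1 : absv sc (- 1) = 1.
Proof. by apply: emb_inj; rewrite -absvE normrN1 rmorph1. Qed.

Context {X : completeNormedModType K}.
Implicit Types (p q : X -> R) (x y : X) (u : nat -> X).
Local Notation rnorm := (rnorm sc).

Lemma emb_rnorm x : emb sc (rnorm x) = `|x|.
Proof. by rewrite /Defs.rnorm -absvE ger0_norm. Qed.

Lemma norm0 p : is_norm sc p -> p 0 = 0.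
Proof. by case=> _ pZ _; rewrite -(scale0r 0) pZ absv0 mul0r. Qed.

Lemma normN p x : is_norm sc p -> p (- x) = p x.
Proof. by case=> _ pZ _; rewrite -scaleN1r pZ absvN1 mul1r. Qed.

Lemma norm_ge0 p x : equivalent_norm sc p -> 0 <= p x.
Proof.
move=> [c [C [c0 C0 /(_ x) /andP[h _]]]]; apply: le_trans h.
by rewrite mulr_ge0 ?absv_ge0 // ltW.
Qed.

Lemma norm_eq0_small p x (c : nat -> R) : is_norm sc p -> equivalent_norm sc p ->
  c @ \oo --> (0 : R) -> (forall n, p x <= c n) -> x = 0.
Proof.
move=> pn pe c0 xc; case: (pn) => _ _; apply.
apply/eqP; rewrite eq_le norm_ge0 // andbT -(cvg_lim _ c0) //.
by apply: limr_ge; [exact: cvgP c0|near=> n; exact: xc].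
Unshelve. all: by end_near. Qed.

Lemma norm_dist p x y z : is_norm sc p -> p (x - z) <= p (x - y) + p (y - z).
Proof. by case=> pD _ _; rewrite -[in leLHS](subrK y x) -addrA pD. Qed.

Lemma norm_sum p (I : Type) (s : seq I) (f : I -> X) : is_norm sc p ->
  p (\sum_(i <- s) f i) <= \sum_(i <- s) p (f i).
Proof.
move=> pn; have pD := let: And3 h _ _ := pn in h.
elim: s => [|i s ih]; first by rewrite !big_nil norm0.
by rewrite !big_cons (le_trans (pD _ _)) // lerD2l.
Qed.

Lemma bounded_op_norm (f : X -> X) p q : bounded_op sc f ->
  equivalent_norm sc p -> equivalent_norm sc q ->
  exists M, 0 <= M /\ forall x, q (f x) <= M * p x.
Proof.
move=> [B fB] [c [c' [c0 _ pc]]] [C' [C [_ C0 qC]]].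
exists (C * (`|B| / c)); split.
  by rewrite mulr_ge0 ?divr_ge0 ?(ltW c0) ?(ltW C0).
move=> y; have /andP[_ h] := qC (f y); apply: (le_trans h).
rewrite -[leRHS]mulrA ler_pM2l // (le_trans (fB y)) //.
rewrite (le_trans (ler_wpM2r (absv_ge0 _) (ler_norm B))) //.
rewrite -[leRHS]mulrA ler_wpM2l // ler_pdivlMl //.
by have /andP[] := pc y.
Qed.

Lemma partial_sums_le p u (c : nat -> R) : is_norm sc p ->
  (forall k, p (u k) <= c k - c k.+1) -> forall m n, (m <= n)%N ->
  p (\sum_(k < n) u k - \sum_(k < m) u k) <= c m - c n.
Proof.
move=> pn uc m n mn; rewrite -!(big_mkord xpredT).
rewrite (big_cat_nat (n := m)) //= addrAC subrr add0r.
apply: (le_trans (norm_sum _ _ pn)).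
apply: (le_trans (ler_sum _ (fun i _ => uc i))).
rewrite -opprB -(telescope_sumr c mn) -sumrN.
by under [leRHS]eq_bigr do rewrite opprB.
Qed.

(** A summation criterion with an explicit remainder: the domination of the terms
    by the differences [c k - c (k+1)] makes the partial sums Cauchy, and bounds
    each remainder by the corresponding tail [c n]. *)
Lemma telescoping_series p u (c : nat -> R) :
  is_norm sc p -> equivalent_norm sc p ->
  (forall k, p (u k) <= c k - c k.+1) -> c @ \oo --> (0 : R) ->
  exists z, forall n, p (z - \sum_(k < n) u k) <= c n.
Proof.
move=> pn pe uc c0.
have cS k : c k.+1 <= c k by rewrite -subr_ge0 (le_trans _ (uc k)) // norm_ge0.
have cd : {homo c : m n / (m <= n)%N >-> n <= m}.
  by apply: homo_leq => // y x z h1 h2; exact: le_trans h2 h1.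
have c_ge0 k : 0 <= c k.
  rewrite -(cvg_lim _ c0) //; apply: limr_le; first exact: cvgP c0.
  by near=> n; apply: cd; near: n; exact: nbhs_infty_ge.
have [a [C [a0 C0 pC]]] := pe.
have cvgS : cvg (series u @ \oo).
  apply/cauchy_cvgP/cauchy_ballP => e e0; near_simpl.
  (* A positive scalar is the image of a positive real, so the Cauchy
     criterion over K reduces to one over R. *)
  have ee : emb sc (absv sc e) = e by rewrite -absvE ger0_norm // ltW.
  have e0' : 0 < absv sc e by rewrite -emb_lt rmorph0 ee.
  have /cvgrPdist_lt /(_ (a * absv sc e)) := c0.
  move=> /(_ (mulr_gt0 a0 e0')) [m _ hm].
  have hb n : (m <= n)%N -> forall k, (n <= k)%N ->
     rnorm (series u k - series u n) < absv sc e.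
    move=> mn k nk; rewrite -(ltr_pM2l a0).
    have /andP[h _] := pC (series u k - series u n); apply: (le_lt_trans h).
    rewrite /series /= !big_mkord (le_lt_trans (partial_sums_le pn uc nk)) //.
    have := hm n mn; rewrite sub0r normrN ger0_norm //=.
    by apply: le_lt_trans; rewrite lerBlDr lerDl.
  exists ([set n | (m <= n)%N], [set n | (m <= n)%N]) => /=.
    by split; exact: nbhs_infty_ge.
  move=> [i j] /= [mi mj]; rewrite -ball_normE /= -emb_rnorm.
  rewrite -[X in _ < X]ee emb_lt.
  have [ij|/ltnW ji] := leqP i j; last exact: hb.
  rewrite /Defs.rnorm distrC; exact: hb.
exists (lim (series u @ \oo)) => n.
apply/ler_addgt0Pr => e e0.
have eC : 0 < emb sc (e / C) by rewrite -(rmorph0 (emb sc)) emb_lt divr_gt0.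
have /cvgrPdist_lt /(_ _ eC) [m _ hm] := cvgS.
set z := lim _ in hm *.
(* The partial sum up to k contains the one up to n and is within e / C of
   the limit z. *)
pose k := maxn m n.
have := hm k (leq_maxl _ _); rewrite -emb_rnorm emb_lt ltr_pdivlMr // mulrC => h1.
rewrite (le_trans (norm_dist _ (\sum_(i < k) u i) _ pn)) // addrC lerD //.
  apply: (le_trans (partial_sums_le pn uc (leq_maxr _ _))).
  by rewrite lerBlDr lerDl.
have /andP[_ h] := pC (z - series u k).
move: h h1; rewrite /series /= big_mkord => /le_trans h h1.
by apply: h; exact: ltW.
Unshelve. all: by end_near. Qed.

End Scalars.

(** * Bounded sequences *)

Section SupNorm.
Context {R : realType} {K : numFieldType}.
Context {X : completeNormedModType K} {N : nat -> X -> R}.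

Lemma supnorm_le (x : nat -> X) (S : R) :
  (forall n, N n (x n) <= S) -> (supnorm N x <= S%:E)%E.
Proof. by move=> xS; apply: ge_ereal_sup => _ [n _ <-]; rewrite lee_fin. Qed.

Lemma Yspace_intro (x : nat -> X) (S : R) :
  (forall n, N n (x n) <= S) -> Yspace N x.
Proof. by move=> /supnorm_le/le_lt_trans; apply; exact: ltry. Qed.

Lemma Yspace_bound (x : nat -> X) : Yspace N x ->
  exists S, supnorm N x = S%:E /\ forall n, N n (x n) <= S.
Proof.
move=> xY; have ub n : ((N n (x n))%:E <= supnorm N x)%E.
  by apply: ereal_sup_ubound; exists n.
have fin : supnorm N x \is a fin_num.
  by rewrite fin_real // xY (lt_le_trans _ (ub 0%N)) ?ltNyr.
exists (fine (supnorm N x)); rewrite fineK //; split=> // n.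
by rewrite -lee_fin fineK.
Qed.

End SupNorm.

(** * Cocycles on the unstable spaces *)

Section Cocycles.
Context {R : realType} {K : numFieldType} {sc : scalars R K}.
Context {X : completeNormedModType K}.
Context {A : nat -> {linear X -> X}} {N : nat -> X -> R}.
Context {P : nat -> {linear X -> X}}.
Hypothesis dich : log_dichotomy A N P.

Lemma cocycleS m n x : (n <= m)%N -> cocycle A m.+1 n x = A m (cocycle A m n x).
Proof. by move=> nm; rewrite /cocycle subSn //= subnKC. Qed.

Lemma cocycle_id n x : cocycle A n n x = x.
Proof. by rewrite /cocycle subnn. Qed.

Lemma cocycleSr m n x : (n < m)%N -> cocycle A m n x = cocycle A m n.+1 (A n x).
Proof.
elim: m => [//|m ih]; rewrite ltnS leq_eqVlt => /predU1P[->|nm].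
  by rewrite cocycleS // !cocycle_id.
by rewrite !cocycleS ?ih // ltnW.
Qed.

(** Iterating [ld_inv]; this is what gives [back_cocycle] its meaning. *)
Lemma cocycle_bij m n : (m <= n)%N ->
  set_bij (Defs.kernel (P m)) (Defs.kernel (P n)) (cocycle A n m).
Proof.
elim: n => [|n ih].
  rewrite leqn0 => /eqP ->; have -> : cocycle A 0 0 = id by apply/funext.
  by split=> // x x0; exists x.
rewrite leq_eqVlt ltnS => /predU1P[->|mn].
  have -> : cocycle A n.+1 n.+1 = id by apply/funext => x; rewrite cocycle_id.
  by split=> // x x0; exists x.
have -> : cocycle A n.+1 m = A n \o cocycle A n m.
  by apply/funext => x; rewrite /= cocycleS.
have [f1 i1 s1] := ih mn; have [f2 i2 s2] := ld_inv dich n; split.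
- by move=> x /f1 /f2.
- move=> x y; rewrite !inE => x0 y0 e; apply: i1; rewrite ?inE //.
  by apply: i2 e; rewrite inE; exact: f1.
- by move=> y /s2[u /s1[v v0 <-] <-]; exists v.
Qed.

Lemma back_cocycle_kernel m n x : (m <= n)%N -> P n x = 0 ->
  P m (back_cocycle A P m n x) = 0.
Proof.
move=> mn xn.
have [f _ _] := bijpinv_bij (fun=> 0) (cocycle_bij mn); exact: f.
Qed.

Lemma back_cocycleK m n x : (m <= n)%N -> P n x = 0 ->
  cocycle A n m (back_cocycle A P m n x) = x.
Proof.
move=> mn xn; have [_ _ s] := cocycle_bij mn.
by apply: (surjpK _ s); rewrite inE.
Qed.

Lemma cocycle_kernel_inj m n x y : (m <= n)%N -> P m x = 0 -> P m y = 0 ->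
  cocycle A n m x = cocycle A n m y -> x = y.
Proof.
move=> mn x0 y0; have [_ i _] := cocycle_bij mn.
by apply: i; rewrite inE.
Qed.

Lemma back_cocycle_unique m n x : (m <= n)%N -> P m x = 0 ->
  back_cocycle A P m n (cocycle A n m x) = x.
Proof.
move=> mn x0; have y0 : P n (cocycle A n m x) = 0.
  by have [f _ _] := cocycle_bij mn; exact: f.
by apply: (@cocycle_kernel_inj m n) => //;
  rewrite ?back_cocycle_kernel ?back_cocycleK.
Qed.

Lemma back_cocycle_step m n x : (m < n)%N -> P n x = 0 ->
  A m (back_cocycle A P m n x) = back_cocycle A P m.+1 n x.
Proof.
move=> mn x0; have mn' := ltnW mn.
apply: (@cocycle_kernel_inj m.+1 n) => //.
- have [f _ _] := ld_inv dich m; apply: f.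
  exact: back_cocycle_kernel.
- exact: back_cocycle_kernel.
- by rewrite -cocycleSr // !back_cocycleK.
Qed.

Lemma compl_proj_kernel n x : P n (compl_proj P n x) = 0.
Proof. by rewrite /compl_proj linearB /= (ld_proj dich) subrr. Qed.

Lemma range_compl_proj n : range (compl_proj P n) = Defs.kernel (P n).
Proof.
apply/seteqP; split=> [_ [x _ <-]|x x0]; first exact: compl_proj_kernel.
by exists x => //; rewrite /compl_proj x0 subr0.
Qed.

End Cocycles.

(** * Bounded solutions of the recurrence *)

(** The bound for each half of the Green function applied to a forcing term of
    size [relgap]; [l] and [D] are the exponent and the constant of the
    dichotomy. *)
Definition green_const {R : realType} (l D : R) := D * (2 / l * 2 `^ l).

Lemma green_const_ge0 {R : realType} (l D : R) :
  0 <= l -> 0 <= D -> 0 <= green_const l D.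
Proof. by move=> l0 D0; rewrite !mulr_ge0 ?powR_ge0 ?invr_ge0. Qed.

Section Green.
Context {R : realType} {K : numFieldType} {sc : scalars R K}.
Context {X : completeNormedModType K}.
Context {A : nat -> {linear X -> X}} {N : nat -> X -> R}.
Context {P : nat -> {linear X -> X}}.
Hypothesis A_bounded : forall n, bounded_op sc (A n).
Hypothesis N_norm : forall m, is_norm sc (N m).
Hypothesis N_equiv : forall m, equivalent_norm sc (N m).
Hypothesis dich : log_dichotomy A N P.
Context {l D : R}.
Hypotheses (l_gt0 : 0 < l) (D_gt0 : 0 < D).
Hypothesis stable : forall m n x, (n <= m)%N ->
  N m (cocycle A m n (P n x)) <= D * (nu m / nu n) `^ (- l) * N n x.
Hypothesis unstable : forall m n x, (m <= n)%N ->
  N m (back_cocycle A P m n (compl_proj P n x))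
    <= D * (nu n / nu m) `^ (- l) * N n x.

(** Pulling [x n], which is unstable, back to time 0 contracts it by the factor
    [(nu n / nu 0) ^ (- l)], while its norm stays bounded. *)
Lemma solution_eq0 x : Yspace N x -> P 0%N (x 0%N) = 0 ->
  (forall n, x n.+1 = A n (x n)) -> forall n, x n = 0.
Proof.
move=> /Yspace_bound[S [_ xS]] x0 xA.
have xE n : x n = cocycle A n 0 (x 0%N).
  by elim: n => [|n ih]; rewrite ?cocycle_id // xA ih cocycleS.
suff x00 : x 0%N = 0 by elim=> [|n ih] //; rewrite xA ih linear0.
apply: (norm_eq0_small (c := fun n => D * nu 0 `^ l * S * nu n `^ (- l))
  (N_norm 0%N) (N_equiv 0%N)).
  rewrite -(mulr0 (D * nu 0 `^ l * S)); apply: cvgMr; exact: nu_powR_cvg0.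
move=> n; have Pxn : P n (x n) = 0.
  by rewrite xE; have [f _ _] := cocycle_bij dich (leq0n n); exact: f.
have := unstable (x n) (leq0n n).
rewrite /compl_proj Pxn subr0 {1}xE (back_cocycle_unique dich) //.
rewrite nu_ratio_powRN => /le_trans; apply.
rewrite (le_trans (ler_wpM2l _ (xS n))) ?mulr_ge0 ?powR_ge0 ?(ltW D_gt0) //.
lra.
Qed.

Context {f : nat -> X} {S : R}.
Hypothesis f_le : forall k, N k (f k) <= relgap k * S.

Let S_ge0 : 0 <= S.
Proof.
have := le_trans (norm_ge0 (f 0%N) (N_equiv 0%N)) (f_le 0%N).
by rewrite pmulr_rge0 // relgap_gt0.
Qed.

Definition stable_part n := \sum_(k < n.+1) cocycle A n k (P k (f k)).

Lemma stable_partS n : stable_part n.+1 = A n (stable_part n) + P n.+1 (f n.+1).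
Proof.
rewrite /stable_part big_ord_recr /= cocycle_id linear_sum /=; congr (_ + _).
by apply: eq_bigr => k _; rewrite cocycleS // -ltnS.
Qed.

(** The sum of the bounds telescopes to less than [nu (n+1) ^ l], which [nu n ^ (- l)]
    compensates up to the factor [2 ^ l]. *)
Lemma stable_part_le n : N n (stable_part n) <= green_const l D * S.
Proof.
apply: (le_trans (norm_sum _ _ (N_norm n))).
apply: (@le_trans _ _ (\sum_(k < n.+1)
   D * S * nu n `^ (- l) * (2 / l) * (nu k.+1 `^ l - nu k `^ l))).
  apply: ler_sum => k _.
  apply: (le_trans (stable _ (leq_ord k))).
  rewrite nu_ratio_powRN.
  have h := f_le k; have h2 := relgap_le_powR_diff k l_gt0.
  have c0 : 0 <= D * (nu k `^ l * nu n `^ (- l)).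
    by rewrite !mulr_ge0 ?powR_ge0 // ltW.
  apply: (le_trans (ler_wpM2l c0 h)).
  have c1 : 0 <= D * S * nu n `^ (- l) by rewrite !mulr_ge0 ?powR_ge0 // ltW.
  have := ler_wpM2l c1 h2; rewrite !mulrA; apply: le_trans.
  lra.
rewrite -mulr_sumr -(big_mkord xpredT (fun k => nu k.+1 `^ l - nu k `^ l)).
rewrite telescope_sumr // /green_const.
have h : (nu n.+1 `^ l) <= 2 `^ l * nu n `^ l :> R.
  rewrite -powRM ?(ltW (nu_gt0 _)) //.
  by rewrite ge0_ler_powR ?nnegrE ?mulr_ge0 ?nuS_le_double
    ?(ltW (nu_gt0 _)) ?(ltW l_gt0).
have c1 : 0 <= D * S * nu n `^ (- l) * (2 / l).
  by rewrite !mulr_ge0 ?powR_ge0 ?invr_ge0 ?(ltW D_gt0) ?(ltW l_gt0).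
have h' : nu n.+1 `^ l - nu 0 `^ l <= 2 `^ l * nu n `^ l :> R.
  by rewrite lerBlDr (le_trans h) // lerDl powR_ge0.
apply: (le_trans (ler_wpM2l c1 h')).
have e : nu n `^ (- l) * nu n `^ l = 1 :> R.
  by rewrite powRN mulVf // gt_eqF // powR_gt0 // nu_gt0.
rewrite le_eqVlt; apply/orP; left; apply/eqP.
transitivity (D * (2 / l * 2 `^ l) * S * (nu n `^ (- l) * nu n `^ l)).
  by ring.
by rewrite e mulr1.
Qed.

(** The terms of the unstable half at time [n] are indexed from [k = n + 1] on,
    and [tail n q] dominates the remainder after the first [q] of them. *)
Let term n i := let k := (n + i.+1)%N in
  back_cocycle A P n k (compl_proj P k (f k)).

Let tail n q : R := green_const l D * S * nu n `^ l * nu (n + q.+1) `^ (- l).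

Lemma term_le n i : N n (term n i) <= tail n i - tail n i.+1.
Proof.
rewrite /term /tail !addnS; set k := (n + i).+1.
have nk : (n <= k)%N by rewrite /k; lia.
apply: (le_trans (unstable _ nk)); rewrite nu_ratio_powRN.
have h2 := relgap_le_powRN_diff k l_gt0.
have c0 : 0 <= D * (nu n `^ l * nu k `^ (- l)).
  by rewrite !mulr_ge0 ?powR_ge0 // ltW.
apply: (le_trans (ler_wpM2l c0 (f_le k))).
have c1 : 0 <= D * S * nu n `^ l by rewrite !mulr_ge0 ?powR_ge0 // ltW.
have := ler_wpM2l c1 h2 => /(le_trans _); rewrite /green_const => h.
apply: (le_trans (h _ _)); lra.
Qed.

Lemma tail_cvg0 n : tail n @ \oo --> (0 : R).
Proof.
rewrite -(mulr0 (green_const l D * S * nu n `^ l)).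
apply: cvgMr; under eq_fun do rewrite addnS -addSn addnC.
by have := nu_powR_cvg0 l_gt0; rewrite -(cvg_shiftn n.+1).
Qed.

Lemma tail0_le n : tail n 0 <= green_const l D * S.
Proof.
have h : nu n `^ l * nu (n + 1) `^ (- l) <= 1 :> R.
  rewrite powRN ler_pdivrMr ?powR_gt0 ?nu_gt0 // mul1r.
  rewrite ge0_ler_powR ?nnegrE ?(ltW (nu_gt0 _)) ?(ltW l_gt0) //.
  by rewrite le_nu // leq_addr.
by rewrite /tail -[leLHS]mulrA ler_piMr // mulr_ge0 // green_const_ge0 // ltW.
Qed.

(** Both identities hold for partial sums, up to a shift of one term, and pass to
    the limit because [P 0] and [A n] are bounded; the boundedness of [P 0] is the
    stable estimate with equal times. *)
Lemma unstable_part : exists z : nat -> X, [/\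
  P 0%N (z 0%N) = 0,
  forall n, N n (z n) <= green_const l D * S &
  forall n, A n (z n) = compl_proj P n.+1 (f n.+1) + z n.+1].
Proof.
have /choice[z zP] n :
    exists z, forall q, N n (z - \sum_(i < q) term n i) <= tail n q.
  apply: (telescoping_series (N_norm n) (N_equiv n)).
    exact: term_le.
  exact: tail_cvg0.
exists z; split.
- have P0_le x : N 0%N (P 0%N x) <= D * N 0%N x.
    have := stable x (leqnn 0).
    by rewrite cocycle_id divff ?gt_eqF ?nu_gt0 // powR1 mulr1.
  apply: (norm_eq0_small (c := fun q => D * tail 0 q) (N_norm 0%N) (N_equiv 0%N)).
    by rewrite -(mulr0 D); apply: cvgMr; exact: tail_cvg0.
  move=> q.
  have -> : P 0%N (z 0%N) = P 0%N (z 0%N - \sum_(i < q) term 0 i).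
    rewrite linearB linear_sum /= big1 ?subr0 // => i _.
    by rewrite (back_cocycle_kernel dich) // (compl_proj_kernel dich).
  by apply: (le_trans (P0_le _)); rewrite ler_wpM2l // ltW.
- move=> n; apply: le_trans (tail0_le n).
  by have := zP n 0%N; rewrite big_ord0 subr0.
move=> n.
have [M [M0 AM]] := bounded_op_norm (A_bounded n) (N_equiv n) (N_equiv n.+1).
apply/eqP; rewrite -subr_eq0; apply/eqP.
apply: (norm_eq0_small (c := fun q => M * tail n q.+1 + tail n.+1 q)
  (N_norm n.+1) (N_equiv n.+1)).
  rewrite -(addr0 0) -{1}(mulr0 M); apply: cvgD; last exact: tail_cvg0.
  by apply: cvgMr; rewrite cvg_shiftS; exact: tail_cvg0.
move=> q.
have shift : A n (\sum_(i < q.+1) term n i) =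
    compl_proj P n.+1 (f n.+1) + \sum_(i < q) term n.+1 i.
  rewrite linear_sum big_ord_recl /=; congr (_ + _).
    rewrite /term addn1 (back_cocycle_step dich) ?(compl_proj_kernel dich) //.
    have := back_cocycle_unique dich (leqnn n.+1)
      (compl_proj_kernel dich n.+1 (f n.+1)).
    by rewrite cocycle_id.
  apply: eq_bigr => i _; rewrite /term /= /bump leq0n add1n addSnnS.
  by rewrite (back_cocycle_step dich) ?(compl_proj_kernel dich) //; lia.
have -> : A n (z n) - (compl_proj P n.+1 (f n.+1) + z n.+1) =
  A n (z n - \sum_(i < q.+1) term n i) - (z n.+1 - \sum_(i < q) term n.+1 i).
  by rewrite linearB /= shift !opprB !opprD !addrA subrK.
have [pD _ _] := N_norm n.+1.
rewrite (le_trans (pD _ _)) // (normN _ (N_norm n.+1)) lerD //.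
by rewrite (le_trans (AM _)) // ler_wpM2l.
Qed.

(** The two halves of the Green function account for the stable and the unstable
    parts of the forcing.  With [f 0 = 0] the stable half vanishes at time 0, which
    leaves the initial value in [ker P 0]. *)
Lemma bounded_solution : f 0%N = 0 -> exists x : nat -> X, [/\
  P 0%N (x 0%N) = 0,
  forall n, N n (x n) <= 2 * green_const l D * S &
  forall n, x n.+1 - A n (x n) = f n.+1].
Proof.
move=> f0; have [z [z0 z_le zA]] := unstable_part.
exists (fun n => stable_part n - z n); split.
- rewrite linearB /= z0 subr0 /stable_part big_ord1 cocycle_id f0.
  by rewrite !linear0.
- move=> n; have [pD _ _] := N_norm n.
  rewrite (le_trans (pD _ _)) // (normN _ (N_norm n)).
  have := lerD (stable_part_le n) (z_le n) => /le_trans; apply.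
  by rewrite -mulrA mulr_natl mulr2n.
- move=> n; rewrite linearB /= zA stable_partS /compl_proj.
  rewrite opprB addrC !addrA subrK.
  by rewrite [X in X - _]addrAC subrK addrK.
Qed.

End Green.

(** * Invertibility *)

Section TopEquation.
Context {R : realType} {K : numFieldType} {sc : scalars R K}.
Context {X : completeNormedModType K} {A : nat -> {linear X -> X}}.

Lemma TopP (x y : nat -> X) : y 0%N = 0 ->
  Top sc A x = y <->
  forall n, x n.+1 - A n (x n) = emb sc (relgap n.+1) *: y n.+1.
Proof.
move=> y0; have w0 n : nu n.+1 / ln (1 + n.+3%:R^-1) != 0 :> R.
  by rewrite -invr_eq0 weight_inv gt_eqF // relgap_gt0.
split=> [<- n|xy].
  by rewrite /= scalerA -rmorphM -weight_inv mulVf // rmorph1 scale1r.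
apply/funext => -[|n] //=.
by rewrite xy scalerA -rmorphM -weight_inv mulfV // rmorph1 scale1r.
Qed.

End TopEquation.

Theorem corollary6p11
  (R : realType) (K : numFieldType) (sc : scalars R K)
  (X : completeNormedModType K)
  (A : nat -> {linear X -> X}) (A_bounded : forall n, bounded_op sc (A n))
  (N : nat -> X -> R)
  (N_norm : forall m, is_norm sc (N m))
  (N_equiv : forall m, equivalent_norm sc (N m))
  (P : nat -> {linear X -> X}) (dich : log_dichotomy A N P) :
  T_invertible sc A N (range (compl_proj P 0%N)).
Proof.
have [l [D [l0 D0 stable unstable]]] := ld_bounds dich.
pose C := 2 * green_const l D.
rewrite (range_compl_proj dich).
set Z := Defs.kernel (P 0%N).
have solve y : Y0 N y -> exists x,
    [/\ Tdom sc A N Z x, Top sc A x = y &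
        (supnorm N x <= C%:E * supnorm N y)%E].
  move=> yY0; have [/Yspace_bound[S [SE yS]] y0] := yY0.
  have f_le k : N k (emb sc (relgap k) *: y k) <= relgap k * S.
    have r0 := ltW (relgap_gt0 (R := R) k).
    have [_ NZ _] := N_norm k.
    by rewrite NZ absv_emb // ler_wpM2l.
  have [|x [x0 xC xE]] := bounded_solution A_bounded N_norm N_equiv dich l0 D0
    stable unstable f_le.
    by rewrite y0 scaler0.
  have Tx : Top sc A x = y by apply/TopP.
  exists x; split=> //.
    by split; [split=> //; exact: Yspace_intro xC|rewrite Tx].
  by rewrite SE -EFinM; exact: supnorm_le.
have inj : {in Tdom sc A N Z &, injective (Top sc A)}.
  move=> x x'; rewrite !inE => -[[xY x0] _] [[x'Y x'0] _] e.
  have [S [_ xS]] := Yspace_bound xY; have [S' [_ xS']] := Yspace_bound x'Y.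
  have step n : x n.+1 - A n (x n) = x' n.+1 - A n (x' n).
    have [/(_ e) xE _] := TopP (sc := sc) (A := A) x
      (y := Top sc A x') erefl.
    have [/(_ erefl) x'E _] := TopP (sc := sc) (A := A) x'
      (y := Top sc A x') erefl.
    by rewrite xE x'E.
  have d0 : forall n, x n - x' n = 0.
    apply: (solution_eq0 N_norm N_equiv dich l0 D0 unstable).
    - apply: (@Yspace_intro _ _ _ _ _ (S + S')) => n.
      have [ND _ _] := N_norm n.
      by rewrite (le_trans (ND _ _)) // (normN _ (N_norm n)) lerD.
    - by rewrite linearB /= x0 x'0 subr0.
    - move=> n; rewrite linearB /=; apply/eqP; rewrite subr_eq -addrA.
      by rewrite [- _ + _]addrC -step addrCA subrr addr0.
  by apply/funext => n; apply/eqP; rewrite -subr_eq0 d0.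
split.
  split=> //; first by move=> x [_].
  by move=> y /solve[x [xT <- _]]; exists x.
exists (C + 1) => y yY0; have [x [xT xE xC]] := solve _ yY0.
have -> : Tinv sc A N Z y = x.
  by rewrite /Tinv -xE pinvKV // inE.
have [/Yspace_bound[S [SE _]] _] := yY0.
rewrite /graph_norm xE (le_trans (leeD2r _ xC)) // SE -EFinM -EFinD -EFinM.
by rewrite mulrDl mul1r.
Qed.
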